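(* Let $n\ge 2$, let $J_{kl}\in\mathbb R$ for $1\le k<l\le n$, and let $$H_{ZZ}:=\pi\sum_{k<l}^n J_{kl}\,\tfrac12\,\sigma_{kz}\otimes\sigma_{lz}.$$ Suppose the coupling graph (vertices $1,\dots,n$; an edge between $k<l$ iff $J_{kl}\neq0$) is connected. Then the evolution under $H_{ZZ}$ is type-I invertible by local unitary operations if and only if its coupling graph is bipartite.
   Context: $\sigma_{kz}\otimes\sigma_{lz}$ denotes the operator on $(\mathbb C^2)^{\otimes n}$ acting as the Pauli matrix $\sigma_z$ on qubits $k$ and $l$ and as the identity on all other qubits. The evolution under a Hamiltonian $H$ is type-I invertible by local unitary operations if there is $K\in\mathbf{SU}(2)^{\otimes n}:=\{K_1\otimes\cdots\otimes K_n:K_\ell\in\mathbf{SU}(2)\}$ with $KHK^{-1}=-H$, equivalently $Ke^{-itH}K^{-1}=e^{itH}$ for all $t\in\mathbb R$. *)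

(* Defs.v *)
From HB Require Import structures.
From mathcomp Require Import all_boot all_order all_algebra.
From mathcomp Require Import spectral complex.
From mathcomp Require Import reals trigo.

Set Implicit Arguments.
Unset Strict Implicit.
Unset Printing Implicit Defensive.

Import Order.TTheory GRing.Theory Num.Theory.
Local Open Scope ring_scope.
Local Open Scope complex_scope.

(* The computational basis of n qubits: 0/1-strings of length n. *)
Notation qbasis n := ({ffun 'I_n -> 'I_2}).

(* Operators on the n-fold tensor power of C^2, as matrices whose rows and
   columns are the basis strings in the order of their finType enumeration. *)
Notation qop R n := ('M[R[i]]_#|{: qbasis n}|).

Section Operators.
Variables (R : realType) (n : nat).

(* K_1 (x) ... (x) K_n, by its entries
   <x| K_1 (x) ... (x) K_n |y> = \prod_l <x_l| K_l |y_l>. *)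
Definition tensn (K : 'I_n -> 'M[R[i]]_2) : qop R n :=
  \matrix_(i, j) \prod_(l < n) K l ((enum_val i : qbasis n) l)
                                   ((enum_val j : qbasis n) l).

Lemma tensn_mul (K L : 'I_n -> 'M[R[i]]_2) :
  tensn K *m tensn L = tensn (fun l => K l *m L l).
Proof.
apply/matrixP => i j; rewrite !mxE.
under [RHS]eq_bigr => l _ do rewrite mxE.
rewrite bigA_distr_bigA (reindex _ (onW_bij _ (@enum_val_bij (qbasis n)))) /=.
by apply: eq_bigr => k _; rewrite !mxE -big_split.
Qed.

Lemma tensn1 : tensn (fun=> 1%:M) = 1%:M.
Proof.
apply/matrixP => i j; rewrite !mxE; have [->|ij] := eqVneq i j.
  by rewrite big1 // => l _; rewrite mxE eqxx.
case: (pickP (fun l => (enum_val i : qbasis n) l != (enum_val j : qbasis n) l)).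
  by move=> l /negPf lP; rewrite (bigD1 l) //= mxE lP mul0r.
move=> eq_ij; case/eqP: ij; apply/enum_val_inj/ffunP => l.
by apply/eqP; rewrite -[_ == _]negbK eq_ij.
Qed.

Definition sigma_z : 'M[R[i]]_2 :=
  \matrix_(i, j) (if i == j then (-1) ^+ i else 0).

(* For distinct k and l. *)
Definition sigma_zz (k l : 'I_n) : qop R n :=
  tensn (fun m => if (m == k) || (m == l) then sigma_z else 1%:M).

Definition SU2 (U : 'M[R[i]]_2) : Prop := U \is unitarymx /\ \det U = 1.

Definition local_SU2 (U : qop R n) : Prop :=
  exists K : 'I_n -> 'M[R[i]]_2, (forall l, SU2 (K l)) /\ U = tensn K.

Definition typeI_invertible_local (H : qop R n) : Prop :=
  exists K : qop R n, local_SU2 K /\ K *m H *m invmx K = - H.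

(* Only the values J k l with k < l are used, here and in coupling_edge. *)
Definition H_ZZ (J : 'I_n -> 'I_n -> R) : qop R n :=
  (pi : R)%:C *: \sum_(k < n) \sum_(l < n | (k < l)%N)
                   (J k l)%:C *: (2^-1 *: sigma_zz k l).

Definition coupling_edge (J : 'I_n -> 'I_n -> R) : rel 'I_n :=
  fun k l => (k < l)%N && (J k l != 0) || (l < k)%N && (J l k != 0).

End Operators.

Definition connected_graph (T : finType) (e : rel T) : Prop :=
  forall x y : T, connect e x y.

Definition bipartite (T : finType) (e : rel T) : Prop :=
  exists A : {set T}, forall x y : T, e x y -> (x \in A) != (y \in A).

(* Main.v *)
(* H_ZZ is diagonal, so K H = - H K says exactly that the energies E satisfy
   E y = - E x whenever <x|K|y> != 0.  As det K_l != 0, either both diagonal or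
   both antidiagonal entries of each K_l are nonzero, so flipping the qubits of
   the second kind negates E at every string; by independence of the Walsh
   functions z_k z_l, every coupled pair has exactly one flipped member.
   Conversely, flipping one side of a bipartition negates every term of E. *)
Require Import Defs.
From mathcomp Require Import all_boot all_order all_algebra.
From mathcomp Require Import ring spectral complex reals trigo.

Set Implicit Arguments.
Unset Strict Implicit.
Unset Printing Implicit Defensive.

Import Order.TTheory GRing.Theory Num.Theory.
Local Open Scope ring_scope.
Local Open Scope complex_scope.

Section Spins.
Variables (R : realType) (n : nat).
Implicit Types (x y : qbasis n) (A : {set 'I_n}) (k l m : 'I_n).

(** The eigenvalue of $\sigma_z$ at qubit [k] on the basis state [x]. *)
Definition spin x k : R := (-1) ^+ (x k : nat).

Definition flip A x : qbasis n :=
  [ffun l => if l \in A then rev_ord (x l) else x l].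

Lemma flipK A : involutive (flip A).
Proof.
by move=> x; apply/ffunP => l; rewrite !ffunE; case: ifP => -> //; apply: rev_ordK.
Qed.

Lemma spin_flip A x k : spin (flip A x) k = (-1) ^+ (k \in A) * spin x k.
Proof.
rewrite /spin ffunE; case: (k \in A); rewrite ?expr0 ?expr1 ?mul1r //.
by case: (x k) => -[|[|//]] ? /=; rewrite ?subn1 ?subnn mulN1r ?opprK.
Qed.

Lemma spin_sqr x k : spin x k * spin x k = 1.
Proof. by rewrite -expr2 /spin sqrr_sign. Qed.

(** Orthogonality of Walsh characters. If the two pairs differ, some qubit [m] occurs an odd number
    of times among [k], [l], [k'], [l']; flipping [m] permutes the strings and negates every
    summand, so the sum equals its own negative. *)
Lemma sum_walsh_mul k l k' l' : (k < l)%N -> (k' < l')%N ->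
  \sum_x (spin x k * spin x l) * (spin x k' * spin x l')
    = ((k == k') && (l == l'))%:R * #|{: qbasis n}|%:R.
Proof.
move=> kl kl'; have [/andP[/eqP <- /eqP <-]|ne] := boolP (_ && _).
  under eq_bigr => x _ do rewrite mulrACA !spin_sqr mulr1.
  by rewrite sumr_const mul1r.
have [m mP] : exists m, odd ((k == m) + (l == m) + (k' == m) + (l' == m)).
  have kNl : k == l = false by rewrite -val_eqE ltn_eqF.
  have [ekk'|kk'] := eqVneq k k'.
    exists l; move: ne; by rewrite -ekk' eqxx /= kNl eqxx eq_sym => /negPf ->.
  (* If [k = l'], then [k' < l' = k < l], so [l] occurs exactly once; if [k] differs from both [k']
     and [l'], then [k] itself does. *)
  have [ekl'|kl1] := eqVneq k l'.
    exists l; rewrite eqxx kNl -ekl' kNl.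
    rewrite -val_eqE /= ltn_eqF //.
    by apply: leq_ltn_trans kl; rewrite ekl' ltnW.
  by exists k; rewrite eqxx ![_ == k]eq_sym kNl (negPf kk') (negPf kl1).
rewrite mul0r; set S := LHS.
suff SN : S = - S by apply/eqP; rewrite -eqNr -SN.
rewrite {1}/S (reindex_inj (inv_inj (flipK [set m]))) /= -sumrN.
apply: eq_bigr => x _; rewrite !spin_flip !inE.
move: mP; rewrite !oddD !oddb -!addbA.
by do 4?[case: (_ == m)] => //= _; rewrite ?expr0 ?expr1; ring.
Qed.

(** Multiplying by the character of the pair [k], [l] and summing over all strings leaves, by
    orthogonality, only [c k l] times the number of strings. *)
Lemma walsh_indep (c : 'I_n -> 'I_n -> R) :
    (forall x, \sum_(k < n) \sum_(l < n | (k < l)%N)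
       c k l * (spin x k * spin x l) = 0) ->
  forall k l, (k < l)%N -> c k l = 0.
Proof.
move=> c0 k l kl; have : \sum_x (\sum_(k < n) \sum_(l < n | (k < l)%N)
    c k l * (spin x k * spin x l)) * (spin x k * spin x l) = 0.
  by rewrite big1 // => x _; rewrite c0 mul0r.
under eq_bigr => x _ do rewrite mulr_suml.
rewrite exchange_big /=.
under eq_bigr => k' _.
  under eq_bigr => x _ do rewrite mulr_suml.
  rewrite exchange_big /=.
  under eq_bigr => l' kl'.
    under eq_bigr => x _ do rewrite -mulrA.
    rewrite -mulr_sumr (sum_walsh_mul kl' kl).
    over.
  over.
rewrite (bigD1 k) //= (bigD1 l) //= !eqxx /= mul1r.
rewrite big1 ?addr0 => [|l' /andP[_ /negPf ->]]; last by rewrite mul0r mulr0.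
rewrite big1 ?addr0 => [/eqP|k' /negPf k'k].
  (* The number of strings is nonzero because the all-zero string exists. *)
  rewrite mulf_eq0 pnatr_eq0 => /orP[/eqP //|/eqP/card0_eq/(_ [ffun=> ord0])].
  by rewrite !inE.
by rewrite big1 // => l' _; rewrite k'k mul0r mulr0.
Qed.

Definition energy (J : 'I_n -> 'I_n -> R) x : R :=
  pi * \sum_(k < n) \sum_(l < n | (k < l)%N) J k l * (2^-1 * (spin x k * spin x l)).

Lemma energy_flip_opp (J : 'I_n -> 'I_n -> R) A :
  (forall x, energy J (flip A x) = - energy J x) <->
  (forall k l, coupling_edge J k l -> (k \in A) != (l \in A)).
Proof.
split=> [EN|bip x].
  suff lt_case k l : (k < l)%N -> J k l != 0 -> (k \in A) != (l \in A).
    move=> k l /orP[] /andP[kl Jkl]; first exact: lt_case.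
    by rewrite eq_sym; apply: lt_case.
  move=> kl; apply: contraNN => /eqP eA; apply/eqP.
  (* [c k l] is the coefficient of [spin x k * spin x l] in $2/\pi$ times
     [energy J (flip A x) + energy J x]. When [A] does not separate [k] from [l] it equals
     [2 * J k l]. *)
  pose c k l := J k l * ((-1) ^+ (k \in A) * (-1) ^+ (l \in A) + 1).
  have : c k l = 0.
    apply: walsh_indep kl => x.
    have /eqP := EN x; rewrite -addr_eq0 /energy -mulrDr mulf_eq0.
    rewrite gt_eqF ?pi_gt0 //= => /eqP/(congr1 (GRing.mul 2)).
    rewrite mulr0 -big_split mulr_sumr; apply: etrans; apply: eq_bigr => k' _ /=.
    rewrite -big_split mulr_sumr; apply: eq_bigr => l' _ /=.
    by rewrite !spin_flip /c; field.
  rewrite /c eA -expr2 sqrr_sign => /eqP; rewrite mulf_eq0 => /orP[/eqP //|].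
  by rewrite (pnatr_eq0 R 2).
rewrite /energy -mulrN -sumrN; congr (_ * _); apply: eq_bigr => k _.
rewrite -sumrN; apply: eq_bigr => l kl.
have [->|Jkl] := eqVneq (J k l) 0; first by rewrite !mul0r oppr0.
have := bip k l; rewrite /coupling_edge kl Jkl => /(_ isT).
rewrite !spin_flip; case: (k \in A); case: (l \in A) => //= _;
  by rewrite ?expr0 ?expr1; ring.
Qed.

Lemma sigma_zzE k l : k != l -> sigma_zz R k l =
  diag_mx (\row_i (spin (enum_val i) k * spin (enum_val i) l)%:C).
Proof.
move=> kl; apply/matrixP => i j; rewrite !mxE; have [->|ij] := eqVneq i j.
  rewrite mulr1n (bigD1 k) //= (bigD1 l) 1?eq_sym //= big1 => [|m /andP[mk ml]].
    rewrite !eqxx orbT /= !mxE !eqxx mulr1 rmorphM /= /spin !rmorphXn /=.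
    by rewrite rmorphN rmorph1.
  by rewrite (negPf mk) (negPf ml) mxE eqxx.
rewrite mulr0n.
(* Off the diagonal the two strings differ at some qubit, where the factor, $\sigma_z$ or the
   identity, has a zero entry. *)
case: (pickP (fun l => (enum_val i : qbasis n) l != (enum_val j : qbasis n) l)).
  move=> m /negPf mP; rewrite (bigD1 m) //=.
  by case: ifP; rewrite mxE mP mul0r.
move=> eq_ij; case/eqP: ij; apply/enum_val_inj/ffunP => m.
by apply/eqP; rewrite -[_ == _]negbK eq_ij.
Qed.

Lemma H_ZZE (J : 'I_n -> 'I_n -> R) :
  H_ZZ J = diag_mx (\row_i (energy J (enum_val i))%:C).
Proof.
apply/matrixP => i j; rewrite !mxE summxE /energy rmorphM -mulrnAr; congr (_ * _).
rewrite rmorph_sum -sumrMnl; apply: eq_bigr => k _.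
rewrite summxE rmorph_sum -sumrMnl; apply: eq_bigr => l kl.
rewrite sigma_zzE; last by rewrite -val_eqE ltn_eqF.
by rewrite !mxE !rmorphM /= fmorphV rmorph_nat -!mulrnAr.
Qed.

Lemma conj_H_ZZ_opp (J : 'I_n -> 'I_n -> R) (K : 'I_n -> 'M[R[i]]_2) :
    (forall l, SU2 (K l)) ->
  tensn K *m H_ZZ J *m invmx (tensn K) = - H_ZZ J <->
  (forall x y, \prod_l K l (x l) (y l) != 0 -> energy J y = - energy J x).
Proof.
(* The tensor product of the inverses is a right inverse of [tensn K], so conjugation by [tensn K]
   can be replaced by an anticommutation relation. *)
move=> KSU; have Ku : tensn K \in unitmx.
  have Kl l : K l *m invmx (K l) = 1%:M.
    by rewrite mulmxV // unitarymx_unit //; case: (KSU l).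
  apply: (proj1 (@mulmx1_unit _ _ _ (tensn (fun l => invmx (K l))) _)).
  rewrite tensn_mul -tensn1; apply/matrixP => i j; rewrite !mxE.
  by apply: eq_bigr => l _; rewrite Kl.
have -> : tensn K *m H_ZZ J *m invmx (tensn K) = - H_ZZ J <->
          tensn K *m H_ZZ J = - H_ZZ J *m tensn K.
  by split=> [<-|->]; rewrite ?mulmxKV ?mulmxK.
rewrite H_ZZE mulNmx mul_mx_diag mul_diag_mx; split=> [eqKH x y Kxy|EN].
  move/matrixP/(_ (enum_rank x) (enum_rank y)): eqKH.
  by rewrite !mxE !enum_rankK [X in - X]mulrC -mulrN => /(mulfI Kxy);
    rewrite -rmorphN => /complexI.
apply/matrixP => i j; rewrite !mxE.
set p := \prod_l _; have [->|/EN ->] := eqVneq p 0.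
  by rewrite mul0r mulr0 oppr0.
by rewrite rmorphN mulrN mulrC.
Qed.

End Spins.

Lemma ord2_cases (a : 'I_2) : a = 0 \/ a = 1.
Proof. by case: a => -[|[|//]] ?; [left|right]; apply: val_inj. Qed.

Lemma rev_ord2_neq (a b : 'I_2) : a != b -> b = rev_ord a.
Proof.
by case: (ord2_cases a) => ->; case: (ord2_cases b) => -> // _; apply: val_inj.
Qed.

Lemma det_mx22 (S : comPzRingType) (M : 'M[S]_2) :
  \det M = M 0 0 * M 1 1 - M 0 1 * M 1 0.
Proof.
rewrite (expand_det_row _ 0) !big_ord_recl big_ord0 addr0 /cofactor !det_mx11 !mxE.
rewrite /= expr0 expr1 mul1r mulN1r mulrN.
by congr (_ * M _ _ - M _ _ * M _ _); apply: val_inj.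
Qed.

(** The diagonal and antidiagonal products cannot both vanish; [b] is true when the antidiagonal is
    selected. *)
Lemma det_mx2_neq0 (F : idomainType) (M : 'M[F]_2) : \det M != 0 ->
  exists b : bool, forall a : 'I_2, M a (if b then rev_ord a else a) != 0.
Proof.
rewrite det_mx22 => dM.
have [d0|] := eqVneq (M 0 0 * M 1 1) 0; last first.
  rewrite mulf_eq0 negb_or => /andP[M0 M1]; exists false => a.
  by case: (ord2_cases a) => ->.
move: dM; rewrite d0 sub0r oppr_eq0 mulf_eq0 negb_or => /andP[M0 M1].
exists true => a.
by case: (ord2_cases a) => ->; rewrite -?(@rev_ord2_neq 0 1) -?(@rev_ord2_neq 1 0).
Qed.

(** This is $i\sigma_y$: it flips a qubit as $\sigma_x$ does, but has determinant 1 instead of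
    -1. *)
Definition rot_y (R : realType) : 'M[R[i]]_2 :=
  \matrix_(i, j) (if i == j then 0 else (-1) ^+ i).

Lemma SU2_rot_y (R : realType) : SU2 (rot_y R).
Proof.
split; last first.
  by rewrite det_mx22 !mxE /=; ring.
apply/unitarymxP/matrixP => i j; rewrite !mxE !big_ord_recl big_ord0 !mxE.
case: (ord2_cases i) => ->; case: (ord2_cases j) => ->;
  rewrite /= ?rmorphXn ?rmorphN ?rmorph1 ?rmorph0 /=; ring.
Qed.

Theorem lemma5 (R : realType) (n : nat) (hn : (2 <= n)%N)
    (J : 'I_n -> 'I_n -> R)
    (hconn : connected_graph (coupling_edge J)) :
  typeI_invertible_local (H_ZZ J) <-> bipartite (coupling_edge J).
Proof.
split=> [[_ [[K [KSU ->]] /(conj_H_ZZ_opp _ KSU) EN]]|[A /energy_flip_opp EN]].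
  have /(_ _)/det_mx2_neq0 Kb l : \det (K l) != 0 by rewrite (KSU l).2 oner_eq0.
  have [b bP] := fin_all_exists Kb.
  (* One side of the bipartition consists of the qubits whose antidiagonal was selected. The entry
     of [tensn K] at [x] and its flip is then a product of nonzero factors. *)
  exists [set l | b l]; apply/energy_flip_opp => x; apply: EN.
  by apply/prodf_neq0 => l _; rewrite ffunE inE.
(* Every factor has one nonzero entry per row, so row [x] of [tensn K] is supported at the single
   column [flip A x]. *)
pose K l := if l \in A then rot_y R else 1%:M.
have KSU l : SU2 (K l).
  rewrite /K; case: ifP => _; first exact: SU2_rot_y.
  by split; rewrite ?det1 //; apply/unitarymxP; rewrite trmx1 map_mx1 mulmx1.
exists (tensn K); split; first by exists K.
apply/conj_H_ZZ_opp => // x y /prodf_neq0 Kxy.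
suff -> : y = flip A x by [].
apply/ffunP => l; have := Kxy l isT; rewrite ffunE /K; case: ifP => _; rewrite mxE.
  by have [_ /eqP //|xy _] := eqVneq (x l) (y l); apply: rev_ord2_neq.
by have [-> //|_ /eqP] := eqVneq (x l) (y l).
Qed.
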